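(* Let $X$ be a compact, complete, separable metric space and let $\mathcal{P}(X)$ be the space of Borel probability measures on $X$ with the topology of weak convergence. Let $J:\mathcal{P}(X)\to\mathbb{R}$ be continuously differentiable in the sense that for every $\mu\in\mathcal{P}(X)$ an influence function $\Psi_\mu$ of $J$ at $\mu$ exists and the map $(\mu,\nu)\mapsto \mathbb{E}_{x\sim\nu}[\Psi_\mu(x)]$ is continuous. Let $\theta\mapsto\mu_\theta\in\mathcal{P}(X)$ (with $\theta$ in a Euclidean space) be differentiable in the sense that $\frac{1}{\|h\|}(\mu_{\theta+h}-\mu_\theta)$ converges to a weak limit as $h\to 0$. Then \[ \nabla_\theta J(\mu_\theta)=\nabla_\theta\, \mathbb{E}_{x\sim\mu_\theta}[\hat\Psi(x)], \] where $\hat\Psi=\Psi_{\mu_\theta}$ is treated as a fixed function $X\to\mathbb{R}$ not depending on $\theta$ (i.e. the gradient on the right acts only through $\mu_\theta$).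
   Context: For $J:\mathcal{P}(X)\to\mathbb{R}$ and $\mu\in\mathcal{P}(X)$, the Gâteaux differential in direction $\chi=\nu-\mu$ ($\nu\in\mathcal{P}(X)$) is $dJ_\mu(\chi)=\lim_{\epsilon\to0^+}\frac{J(\mu+\epsilon\chi)-J(\mu)}{\epsilon}$. A function $\Psi_\mu:X\to\mathbb{R}$ is an influence function for $J$ at $\mu$ if $dJ_\mu(\chi)=\int_X\Psi_\mu(x)\,\chi(dx)$ for all $\chi=\nu-\mu$ with $\nu\in\mathcal{P}(X)$. *)

(* Defs.v *)
From HB Require Import structures.
From mathcomp Require Import all_boot all_order all_algebra.
From mathcomp Require Import all_classical all_reals all_analysis.
Set Implicit Arguments. Unset Strict Implicit. Unset Printing Implicit Defensive.
Import Order.TTheory GRing.Theory Num.Theory.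
Import numFieldNormedType.Exports.
Local Open Scope classical_set_scope.
Local Open Scope ring_scope.

Definition borel (X : ptopologicalType) : measurableType ((@open X).-sigma) :=
  g_sigma_algebraType (@open X).

Section mix.
Context d (T : measurableType d) (R : realType).
Variables (mu nu : probability T R) (e : {i01 R}).

Let p : {nonneg R} := (1 - e%:num)%:nng.
Let q : {nonneg R} := (e%:num)%:nng.

Definition pmix : set T -> \bar R := measure_add (mscale p mu) (mscale q nu).
HB.instance Definition _ := Measure.on pmix.

Lemma pmix_setT : pmix setT = 1%E.
Proof.
rewrite /pmix measure_addE /= /mscale /= !probability_setT !mule1.
by rewrite -EFinD subrK.
Qed.

HB.instance Definition _ := Measure_isProbability.Build _ _ _ pmix pmix_setT.
End mix.

(* clamping a real number into [0, 1] (only used near 0+, where it is the identity) *)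
Section clamp.
Context (R : realType).
Lemma clamp01_ge0 (r : R) : 0 <= Num.min (Num.max r 0) 1.
Proof. by rewrite le_min ler01 andbT le_max lexx orbT. Qed.
Lemma clamp01_le1 (r : R) : Num.min (Num.max r 0) 1 <= 1.
Proof. by rewrite ge_min lexx orbT. Qed.
Definition clamp01 (r : R) : {i01 R} := Itv01 (clamp01_ge0 r) (clamp01_le1 r).
End clamp.

Section weak.
Context (R : realType) (X : pseudoPMetricType R).
Local Notation P := (probability (borel X) R).

Definition expect (nu : P) (f : X -> R) : R := Rintegral nu setT f.

Definition bounded_continuous (f : X -> R) : Prop :=
  continuous f /\ exists M : R, forall x, `|f x| <= M.

(* Psi is an influence function of J at mu (Gateaux differential in every
   direction chi = nu - mu equals \int Psi d chi) *)
Definition influence_function (J : P -> R) (mu : P) (Psi : X -> R) : Prop :=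
  (forall nu : P, nu.-integrable setT (EFin \o Psi)) /\
  forall nu : P,
    (fun eps : R => (J (pmix mu nu (clamp01 eps)) - J mu) / eps) @ 0^'+ -->
      (expect nu Psi - expect mu Psi).

Definition weak_ball (mu : P) (k : nat) (f : 'I_k -> X -> R) (delta : R) : set P :=
  [set mu' | forall i, `|expect mu' (f i) - expect mu (f i)| < delta].

Definition weak_continuous2 (Phi : P -> P -> R) : Prop :=
  forall (mu nu : P) (eps : R), 0 < eps ->
    exists (k : nat) (f g : 'I_k -> X -> R) (delta : R),
      [/\ forall i, bounded_continuous (f i),
          forall i, bounded_continuous (g i),
          0 < delta &
          forall mu' nu', weak_ball mu f delta mu' -> weak_ball nu g delta nu' ->
            `|Phi mu' nu' - Phi mu nu| < eps].

Definition weakly_differentiable (n : nat) (m : 'rV[R]_n -> P) : Prop :=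
  forall f : X -> R, bounded_continuous f ->
    forall theta, differentiable (fun t => expect (m t) f) theta.

End weak.

Definition complete_space (R : realType) (X : pseudoPMetricType R) : Prop :=
  forall F : set_system X, ProperFilter F -> cauchy F -> cvg F.

Definition separable_space (X : topologicalType) : Prop :=
  exists D : set X, countable D /\ closure D = setT.

(* Main.v *)
(** The function Psi_mu is continuous in x, and Psi_mu' -> Psi_mu uniformly on
    the compact space X as mu' -> mu weakly: evaluate the jointly continuous map
    (mu, nu) |-> E_nu[Psi_mu] at Dirac masses. Along the segment from mu to nu,
    J has derivative E_nu[Psi] - E_mu[Psi] with Psi the influence function at
    the current point, so the mean value theorem gives
      J(nu) - J(mu) = \int Psi_{mu_t} d(nu - mu)   for some 0 < t < 1.
    With mu = m(theta), nu = m(theta + h), the functionals f |-> \int f d(nu - mu) / |h|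
    are pointwise bounded by weak differentiability, hence uniformly bounded on
    the unit ball of C(X) (uniform boundedness principle); therefore replacing
    Psi_{mu_t} by Psi_mu costs only o(|h|). *)

Require Import Defs.
From HB Require Import structures.
From mathcomp Require Import all_boot all_order all_algebra.
From mathcomp Require Import all_classical all_reals all_analysis.
From mathcomp Require Import measurable_realfun ring lra.
Import Order.TTheory GRing.Theory Num.Theory.
Import numFieldNormedType.Exports.
Local Open Scope classical_set_scope.
Local Open Scope ring_scope.

(** * Uniform boundedness principle on the space of bounded continuous functions *)

Section uniform_boundedness.
Context {R : realType}.

(** The constant [3 / 2 * 3^-1 ^+ n] is the tail sum of the steps from [n] on. Hence the intervals
    of that radius around [F n x] are nested, and the supremum of their left endpoints lies in all
    of them. *)
Lemma geometric_uniform_limit {X : Type} (F : nat -> X -> R) :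
  (forall n x, `|F n.+1 x - F n x| <= 3^-1 ^+ n) ->
  exists f : X -> R, forall n x, `|f x - F n x| <= 3 / 2 * 3^-1 ^+ n.
Proof.
move=> Fstep; pose c n : R := 3 / 2 * 3^-1 ^+ n.
have c0 n : 0 <= c n by rewrite mulr_ge0// exprn_ge0.
have cS n : c n = c n.+1 + 3^-1 ^+ n by rewrite /c exprS; field.
have step n x : F n x - c n <= F n.+1 x - c n.+1 /\
                F n.+1 x + c n.+1 <= F n x + c n.
  by move: (Fstep n x); rewrite ler_norml => /andP[? ?]; rewrite !(cS n); split; lra.
have lo x m n : (m <= n)%N -> F m x - c m <= F n x - c n.
  move=> /subnKC <-; elim: (n - m)%N => [|p IH]; first by rewrite addn0.
  by rewrite addnS (le_trans IH)// (step _ _).1.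
have hi x m n : (m <= n)%N -> F n x + c n <= F m x + c m.
  move=> /subnKC <-; elim: (n - m)%N => [|p IH]; first by rewrite addn0.
  by rewrite addnS (le_trans _ IH)// (step _ _).2.
have lohi x m n : F m x - c m <= F n x + c n.
  have := lo x _ _ (leq_maxl m n); have := hi x _ _ (leq_maxr m n).
  have := c0 (maxn m n); lra.
pose S x := range (fun m => F m x - c m).
exists (fun x => sup (S x)) => n x.
rewrite ler_distl; apply/andP; split.
  apply: ub_le_sup; last by exists n.
  by exists (F 0%N x + c 0%N) => _ [m _ <-]; exact: lohi.
apply: ge_sup; first by exists (F 0%N x - c 0%N), 0%N.
by move=> _ [m _ <-]; exact: lohi.
Qed.

Context {X : pseudoPMetricType R}.
Implicit Types f g : X -> R.

Lemma bounded_continuousD f g : bounded_continuous f -> bounded_continuous g ->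
  bounded_continuous (fun x => f x + g x).
Proof.
move=> [cf [M fM]] [cg [N gN]]; split.
  by move=> x; apply: cvgD; [exact: cf|exact: cg].
by exists (M + N) => x; rewrite (le_trans (ler_normD _ _))// lerD.
Qed.

Lemma bounded_continuousZ (c : R) f : bounded_continuous f ->
  bounded_continuous (fun x => c * f x).
Proof.
move=> [cf [M fM]]; split.
  by move=> x; apply: cvgM; [exact: cvg_cst|exact: cf].
by exists (`|c| * M) => x; rewrite normrM ler_wpM2l.
Qed.

Lemma bounded_continuous_uniform_limit (F : nat -> X -> R) f (c : nat -> R) :
  (forall n, bounded_continuous (F n)) -> c n @[n --> \oo] --> 0 ->
  (forall n x, `|f x - F n x| <= c n) -> bounded_continuous f.
Proof.
move=> bF c0 fF; split; last first.
  have [_ [M FM]] := bF 0%N; exists (c 0%N + M) => x.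
  by rewrite -(subrK (F 0%N x) (f x)) (le_trans (ler_normD _ _))// lerD.
move=> x; apply/cvgrPdist_lt => e e0.
have e3 : 0 < e / 3 by rewrite divr_gt0.
have [n _ /(_ n (leqnn n)) /= cn] := iffLR (cvgrPdist_lt _ _) c0 _ e3.
have {}cn : c n < e / 3.
  by rewrite (le_lt_trans (ler_norm _))// -normrN -sub0r.
have [cF _] := bF n.
near=> y.
have Fxy : `|F n x - F n y| < e / 3.
  by near: y; exact: (iffLR (cvgrPdist_lt _ _) (cF x) _ e3).
rewrite (_ : f x - f y = (f x - F n x) + (F n x - F n y) + - (f y - F n y)); last ring.
have := ler_normD (f x - F n x + (F n x - F n y)) (- (f y - F n y)).
have := ler_normD (f x - F n x) (F n x - F n y).
have := fF n x; have := fF n y; rewrite normrN; lra.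
Unshelve. all: by end_near. Qed.

Context {I : Type} (D : I -> (X -> R) -> R).
Hypothesis DD : forall i f g, bounded_continuous f -> bounded_continuous g ->
  D i (fun x => f x + g x) = D i f + D i g.
Hypothesis DZ : forall i (c : R) f, bounded_continuous f ->
  D i (fun x => c * f x) = c * D i f.
Hypothesis Dbounded : forall i, exists C : R, forall f (M : R), bounded_continuous f ->
  (forall x, `|f x| <= M) -> `|D i f| <= C * M.
Hypothesis Dpointwise : forall f, bounded_continuous f ->
  exists B : R, forall i, `|D i f| <= B.

Let op_bound i (N : R) := forall f (M : R), bounded_continuous f ->
  (forall x, `|f x| <= M) -> `|D i f| <= N * M.

(** The number [N] is the operator norm of [D i], the supremum of its absolute values on the unit
    ball, and [g] nearly attains it. The factor 3/4 leaves a margin over the 1/2 lost to the tail of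
    the series in the gliding-hump argument. *)
Lemma almost_norming i (B : R) : 0 <= B -> ~ op_bound i B ->
  exists N g, [/\ B <= N, op_bound i N, bounded_continuous g,
    forall x, `|g x| <= 1 & 3 / 4 * N < `|D i g|].
Proof.
move=> B0 nB; have [C DC] := Dbounded i.
pose S : set R := [set r | exists g, [/\ bounded_continuous g,
  forall x, `|g x| <= 1 & r = `|D i g|]].
have Sub : has_ubound S.
  by exists C => _ [g [bg g1 ->]]; rewrite (le_trans (DC _ _ bg g1))// mulr1.
have opS : op_bound i (sup S).
  move=> f M bf fM; have := le_trans (normr_ge0 _) (fM point).
  rewrite le_eqVlt => /predU1P[M0|M0].
    by have := DC _ _ bf fM; rewrite -M0 !mulr0.
  have : `|D i (fun x => M^-1 * f x)| <= sup S.
    apply: ub_le_sup => //; exists (fun x => M^-1 * f x); split => //.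
      exact: bounded_continuousZ.
    by move=> x; rewrite normrM gtr0_norm ?invr_gt0// mulrC ler_pdivrMr// mul1r.
  by rewrite DZ// normrM gtr0_norm ?invr_gt0// mulrC ler_pdivrMr.
have BS : B < sup S.
  rewrite ltNge; apply/negP => SB; apply: nB => f M bf fM.
  apply: (le_trans (opS _ _ bf fM)); apply: ler_wpM2r => //.
  exact: le_trans (normr_ge0 _) (fM point).
have S0 : 0 < sup S by exact: le_lt_trans BS.
have hS : has_sup S.
  split => //; exists `|D i (fun=> 0)|, (fun=> 0); split => //.
    by split; [move=> x; exact: cvg_cst|exists 0 => x; rewrite normr0].
  by move=> x; rewrite normr0.
have S4 : 0 < sup S / 4 by rewrite divr_gt0.
have [_ [g [bg g1 ->]] Sg] := sup_adherent S4 hS.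
exists (sup S), g; split => //; first exact: ltW.
by apply: le_lt_trans Sg; lra.
Qed.

(* A. Sokal's proof of the uniform boundedness principle: of f + g and f - g,
   one has image at least that of g, so a geometric series with signs chosen
   greedily has unbounded images. *)
Theorem uniform_boundedness : exists B, forall i, op_bound i B.
Proof.
apply: contrapT => /forallNP noB.
(* Norms at least [4 ^+ n] outgrow the weights [3^-1 ^+ n] of the series, so the products grow like
   [(4 / 3) ^+ n]. *)
have pick n : exists w : I * R * (X -> R), [/\ 4 ^+ n <= w.1.2, op_bound w.1.1 w.1.2,
    bounded_continuous w.2, forall x, `|w.2 x| <= 1 & 3 / 4 * w.1.2 < `|D w.1.1 w.2|].
  have /existsNP[i] := noB (4 ^+ n).
  by move=> /almost_norming[|N [g []]]; [rewrite exprn_ge0|exists (i, N, g)].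
have [w wP] := choice pick; clear pick noB.
pose i_ n := (w n).1.1; pose N_ n := (w n).1.2; pose g_ n := (w n).2.
pose s n f : R := if 3^-1 ^+ n * `|D (i_ n) (g_ n)| <=
    `|D (i_ n) (fun x => f x + 3^-1 ^+ n * g_ n x)| then 3^-1 ^+ n else - 3^-1 ^+ n.
pose F := fix F n : X -> R :=
  if n is p.+1 then fun x => F p x + s p (F p) * g_ p x else fun=> 0.
have q0 n : 0 <= 3^-1 ^+ n :> R by rewrite exprn_ge0.
have bg n : bounded_continuous (g_ n) by have [] := wP n.
have bF n : bounded_continuous (F n).
  elim: n => [|n IH] /=.
    by split; [move=> x; exact: cvg_cst|exists 0 => x; rewrite normr0].
  exact/bounded_continuousD/bounded_continuousZ.
(* The images under the two signs, [a + q * b] and [a - q * b], differ by [2 * q * b]. If the plus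
   sign fails the test, the minus sign must pass it. *)
have DF n : 3^-1 ^+ n * `|D (i_ n) (g_ n)| <= `|D (i_ n) (F n.+1)|.
  rewrite /= {1}/s; case: ifPn => //; rewrite -ltNge.
  rewrite !DD ?DZ//; do ?exact: bounded_continuousZ.
  set a := D _ (F n); set b := D _ (g_ n); set q := 3^-1 ^+ n.
  have qb : `|q * b| = q * `|b| by rewrite normrM ger0_norm// q0.
  rewrite mulNr.
  have := ler_normB (a + q * b) (a - q * b).
  rewrite (_ : a + q * b - (a - q * b) = q * b + q * b); last by ring.
  rewrite -mulr2n normrMn mulr2n qb; lra.
have step n x : `|F n.+1 x - F n x| <= 3^-1 ^+ n.
  rewrite /= addrC addKr normrM (_ : `|s _ _| = 3^-1 ^+ n); last first.
    by rewrite /s; case: ifP => _; rewrite ?normrN ger0_norm.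
  by rewrite ler_piMr//; have [_ _ _ ->] := wP n.
have [f fF] := geometric_uniform_limit _ step.
have bf : bounded_continuous f.
  apply: (bounded_continuous_uniform_limit _ _ _ bF _ fF).
  rewrite -[X in _ --> X](mulr0 (3 / 2)); apply: cvgM; first exact: cvg_cst.
  by apply: cvg_expr; rewrite ger0_norm// invf_lt1// ltr1n.
have [B DB] := Dpointwise _ bf.
(* The tail [f - F n.+1] is at most half of [3^-1 ^+ n], so it costs at most [N_ n * 3^-1 ^+ n / 2]
   out of the 3/4 secured by [DF]. A quarter remains. *)
have big n : 4^-1 * (4 / 3) ^+ n <= B.
  have [NB opN _ _ Ng] := wP n; rewrite -/(i_ n) -/(N_ n) -/(g_ n) in NB opN Ng.
  apply: le_trans (DB (i_ n)).
  have := opN (fun x => f x + -1 * F n.+1 x) (2^-1 * 3^-1 ^+ n).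
  rewrite DD ?DZ//; last exact: bounded_continuousZ.
  move=> /(_ _ _)/wrap[]; first exact/bounded_continuousD/bounded_continuousZ.
    move=> x; rewrite mulN1r (le_trans (fF _ _))// exprS.
    by rewrite le_eqVlt; apply/orP; left; apply/eqP; field.
  rewrite mulN1r => Df.
  have := ler_normB (D (i_ n) f) (D (i_ n) f - D (i_ n) (F n.+1)).
  rewrite opprB addrC subrK => tri.
  have := DF n => DFn.
  have h1 : 3^-1 ^+ n * (3 / 4 * N_ n) <= 3^-1 ^+ n * `|D (i_ n) (g_ n)|.
    by rewrite ler_wpM2l// ltW.
  have h2 : (4 / 3) ^+ n <= N_ n * 3^-1 ^+ n by rewrite exprMn ler_wpM2r.
  lra.
have bernoulli n : 1 + n%:R / 3 <= (4 / 3) ^+ n :> R.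
  elim: n => [|n IH]; first by rewrite expr0 mul0r addr0.
  by rewrite exprS -natr1; have : 0 <= n%:R :> R := ler0n _ _; lra.
(* For [n] above [12 * B], the Bernoulli bound pushes a quarter of [(4 / 3) ^+ n] past [B]. *)
have := archi_boundP (normr_ge0 (12 * B)); set n := Num.bound _.
have := ler_norm (12 * B); have := big n; have := bernoulli n; lra.
Qed.

End uniform_boundedness.

(** * Convex combinations of probability measures *)

Section probability_mixtures.
Context {R : realType}.

(** Besides the set function, a probability carries only proofs, which are equal by proof
    irrelevance. This allows rewriting measures inside the argument of [J]. *)
Lemma eq_probability {d} {T : measurableType d} (mu nu : probability T R) :
  mu = nu :> (set T -> \bar R) -> mu = nu.
Proof.
case: mu nu => [m c] [m' c'] /= e; move: c c'; rewrite -{}e {m'} => c c'.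
have -> // : c = c'.
case: c => -[a1 a2] [a3] [a4] [a5] [a6] [a7] [a8].
case: c' => -[b1 b2] [b3] [b4] [b5] [b6] [b7] [b8].
by rewrite (Prop_irrelevance a1 b1) (Prop_irrelevance a2 b2)
  (Prop_irrelevance a3 b3) (Prop_irrelevance a4 b4) (Prop_irrelevance a5 b5)
  (Prop_irrelevance a6 b6) (Prop_irrelevance a7 b7) (Prop_irrelevance a8 b8).
Qed.

Lemma pmixE {d} {T : measurableType d} (mu nu : probability T R) (e : {i01 R}) A :
  (pmix mu nu e A = (1 - e%:num)%:E * mu A + (e%:num)%:E * nu A)%E.
Proof. by rewrite /pmix measure_addE. Qed.

Lemma clamp01K (t : R) : 0 <= t <= 1 -> (clamp01 t)%:num = t.
Proof.
by move=> /andP[t0 t1] /=; rewrite max_l// min_l.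
Qed.

(** Linearity in the measure is proved for nonnegative integrands and applied to the positive and
    negative parts. Integrability makes the four integrals finite, which reduces the claim to real
    arithmetic. *)
Lemma Rintegral_pmix {d} {T : measurableType d} (mu nu : probability T R)
    (e : {i01 R}) (f : T -> R) :
  mu.-integrable setT (EFin \o f) -> nu.-integrable setT (EFin \o f) ->
  Rintegral (pmix mu nu e) setT f =
  (1 - e%:num) * Rintegral mu setT f + e%:num * Rintegral nu setT f.
Proof.
move=> imu inu; have [/= mf _] := integrableP _ _ _ imu.
have posE (F : T -> \bar R) : measurable_fun setT F -> (forall x, 0 <= F x)%E ->
  (\int[pmix mu nu e]_x F x =
   (1 - e%:num)%:E * \int[mu]_x F x + (e%:num)%:E * \int[nu]_x F x)%E.
  move=> mF F0; rewrite ge0_integral_measure_add//.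
  by rewrite !ge0_integral_mscale.
rewrite /Rintegral.
rewrite (integralE (pmix mu nu e)) (integralE mu) (integralE nu).
rewrite !posE//; [|exact: measurable_funeneg|exact: measurable_funepos].
have := integrable_funepos measurableT imu.
have := integrable_funepos measurableT inu.
have := integrable_funeneg measurableT imu.
have := integrable_funeneg measurableT inu.
do 4 move=> /(integrable_fin_num measurableT)/fineK => <-.
rewrite /=; ring.
Qed.
End probability_mixtures.

(** * Expectations of bounded continuous functions and at Dirac masses *)

Section expectation.
Context {R : realType} {X : pseudoPMetricType R}.
Local Notation P := (probability (borel X) R).
Implicit Types (mu nu : P) (f g : X -> R).

Lemma continuous_borel_measurable f : continuous f ->
  measurable_fun [set: borel X] (f : borel X -> R).
Proof.
move=> /continuousP cf; apply: (measurability _ (RGenOpens.measurableE R)).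
move=> _ [_ [a [b ->] <-]]; rewrite setTI.
by apply: sub_sigma_algebra; exact/cf/interval_open.
Qed.

Lemma bounded_continuous_integrable nu f : bounded_continuous f ->
  nu.-integrable [set: borel X] (EFin \o f).
Proof.
move=> [/continuous_borel_measurable mf [M fM]].
apply: measurable_bounded_integrable => //.
  by rewrite (le_lt_trans (probability_le1 _ _))// ltry.
exists M; split; first exact: num_real.
by move=> N MN x _; exact: le_trans (fM x) (ltW MN).
Qed.

Lemma expectD nu f g : bounded_continuous f -> bounded_continuous g ->
  expect nu (fun x => f x + g x) = expect nu f + expect nu g.
Proof.
by move=> bf bg; apply: RintegralD => //; exact: bounded_continuous_integrable.
Qed.

Lemma expectZ nu (c : R) f : bounded_continuous f ->
  expect nu (fun x => c * f x) = c * expect nu f.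
Proof.
by move=> bf; apply: RintegralZl => //; exact: bounded_continuous_integrable.
Qed.

Lemma ler_norm_expect nu f (M : R) : bounded_continuous f ->
  (forall x, `|f x| <= M) -> `|expect nu f| <= M.
Proof.
move=> bf fM.
have bM (c : R) : bounded_continuous (fun=> c : R^o).
  by split; [move=> x; exact: cvg_cst|exists `|c| => x].
have expect_cst (c : R) : expect nu (fun=> c) = c.
  apply: etrans (Rintegral_cst nu measurableT c) _.
  rewrite -[RHS]mulr1; congr (_ * _).
  exact: (congr1 fine (probability_setT nu)).
rewrite ler_norml -{1}(expect_cst (- M)) -{2}(expect_cst M).
by apply/andP; split; (apply: le_Rintegral => //;
  [exact: bounded_continuous_integrable..|move=> x _];
  have := fM x; rewrite ler_norml => /andP[]).
Qed.

Lemma expect_pmix mu nu (e : {i01 R}) f :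
  mu.-integrable [set: borel X] (EFin \o f) ->
  nu.-integrable [set: borel X] (EFin \o f) ->
  expect (pmix mu nu e) f = (1 - e%:num) * expect mu f + e%:num * expect nu f.
Proof.
exact: Rintegral_pmix.
Qed.

Lemma expect_dirac (x : X) f :
  measurable_fun [set: borel X] (f : borel X -> R) ->
  expect (\d_(x : borel X)) f = f x.
Proof.
move=> mf; rewrite /expect /Rintegral integral_dirac//.
  by rewrite diracT mul1e.
exact/measurable_EFinP.
Qed.
End expectation.

(** * The segment between two probability measures *)

Section segment.
Context {R : realType} {d} {T : measurableType d}.
Implicit Types mu nu : probability T R.

(** Clamping makes the path total in the real parameter [t], as one-variable calculus requires; it
    is constant outside [0, 1]. *)
Definition segment mu nu (t : R) : probability T R := pmix mu nu (clamp01 t).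

Lemma segmentE mu nu (t : R) A : 0 <= t <= 1 ->
  (segment mu nu t A = (1 - t)%:E * mu A + t%:E * nu A)%E.
Proof.
move=> t01; apply: etrans (pmixE mu nu (clamp01 t) A) _.
by rewrite clamp01K.
Qed.

Lemma segment0 mu nu : segment mu nu 0 = mu.
Proof.
apply: eq_probability; apply/funext => A; rewrite segmentE ?lexx ?ler01//.
by rewrite subr0 mul1e mul0e adde0.
Qed.

Lemma segment_sym mu nu (t : R) : 0 <= t <= 1 -> segment mu nu (1 - t) = segment nu mu t.
Proof.
move=> t01; apply: eq_probability; apply/funext => A.
rewrite !segmentE//; last by lra.
by rewrite subKr addeC.
Qed.

Lemma segment1 mu nu : segment mu nu 1 = nu.
Proof. by rewrite -[1]subr0 segment_sym ?segment0// lexx ler01. Qed.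

(** The mass left on [mu] is [(1 - t) * (1 - s)]. This turns a Gateaux step taken at a point of the
    segment into a step along the segment itself. *)
Lemma segment_segment mu nu (s t : R) : 0 <= s <= 1 -> 0 <= t <= 1 ->
  segment (segment mu nu s) nu t = segment mu nu (s + t * (1 - s)).
Proof.
move=> /andP[s0 s1] /andP[t0 t1]; apply: eq_probability; apply/funext => A.
have h1 : 0 <= t * (1 - s) by rewrite mulr_ge0// subr_ge0.
have h2 : t * (1 - s) <= 1 - s by rewrite ler_piMl// subr_ge0.
rewrite !segmentE ?s0 ?t0//; last by lra.
rewrite ge0_muleDr ?mule_ge0 ?lee_fin ?subr_ge0//.
rewrite !muleA -addeA -ge0_muleDl ?mule_ge0 ?lee_fin ?subr_ge0//.
rewrite -!EFinM -EFinD; congr (_%:E * _ + _%:E * _)%E; ring.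
Qed.

End segment.

(** * Mean value theorem for [J] along a segment *)

Section mean_value.
Context {R : realType} {X : pseudoPMetricType R}.
Local Notation P := (probability (borel X) R).
Variables (J : P -> R) (Psi : P -> X -> R).
Hypothesis inflJ : forall mu, influence_function J mu (Psi mu).
Implicit Types mu nu : P.

Lemma expect_segment mu nu (t : R) (f : X -> R) : 0 <= t <= 1 ->
  mu.-integrable [set: borel X] (EFin \o f) ->
  nu.-integrable [set: borel X] (EFin \o f) ->
  expect (segment mu nu t) f = (1 - t) * expect mu f + t * expect nu f.
Proof.
move=> t01 imu inu; have := expect_pmix mu nu (clamp01 t) f imu inu.
by rewrite clamp01K.
Qed.

(** Advancing the parameter by [h] is a Gateaux step of size [h / (1 - t)] from [m0] towards [nu].
    The resulting factor [(1 - t)^-1] cancels, since the expectations under [nu] and [m0] differ by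
    [1 - t] times the difference under [nu] and [mu]. *)
Lemma right_derivative_segment mu nu (t : R) : 0 <= t < 1 ->
  h^-1 * (J (segment mu nu (t + h)) - J (segment mu nu t)) @[h --> 0^'+] -->
  expect nu (Psi (segment mu nu t)) - expect mu (Psi (segment mu nu t)).
Proof.
move=> /andP[t0 t1]; set m0 := segment mu nu t.
have [intP cvgJ] := inflJ m0.
have s0 : 0 < 1 - t by rewrite subr_gt0.
apply/cvgrPdist_lt => e e0.
have es0 : 0 < e * (1 - t) by rewrite mulr_gt0.
have [r /= r0 hr] := iffLR (cvgrPdist_lt _ _) (cvgJ nu) _ es0.
near=> h.
have h0 : 0 < h by near: h; exact: nbhs_right_gt.
have hr' : h < r * (1 - t) by near: h; apply: nbhs_right_lt; rewrite mulr_gt0.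
have h1 : h < 1 - t by near: h; apply: nbhs_right_lt.
have := hr (h / (1 - t)); rewrite /= sub0r normrN gtr0_norm ?divr_gt0//.
rewrite ltr_pdivrMr// => /(_ hr' isT).
rewrite -/(segment m0 nu (h / (1 - t))) segment_segment; last 2 first.
- by rewrite t0 ltW.
- by apply/andP; split; [rewrite divr_ge0// ltW|rewrite ler_pdivrMr// mul1r ltW].
rewrite divfK ?gt_eqF// {1}/m0 expect_segment ?t0 ?ltW//.
rewrite -ltr_pdivrMr// -[X in _ / X](gtr0_norm s0) -normf_div -/m0.
set a := expect nu _; set b := expect mu _; congr (`|_| < _).
by field; rewrite !gt_eqF.
Unshelve. all: by end_near. Qed.

(** The right difference quotient at 0 has a finite limit, so its product with [h] tends to 0. *)
Lemma right_continuous_segment mu nu :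
  J (segment mu nu h) @[h --> 0^'+] --> J mu.
Proof.
have := @right_derivative_segment mu nu 0; rewrite lexx ltr01 => /(_ isT).
rewrite segment0; set L := _ - _ => cvgL.
rewrite -[X in _ --> X](_ : 0 * L + J mu = _); last by rewrite mul0r add0r.
have cvgh : h @[h --> (0 : R)^'+] --> (0 : R) by exact: cvg_within.
have cvgD' : h * (h^-1 * (J (segment mu nu (0 + h)) - J mu)) + J mu
    @[h --> 0^'+] --> 0 * L + J mu.
  by apply: cvgD; [exact: cvgM|exact: cvg_cst].
apply: cvg_trans cvgD'.
apply: near_eq_cvg; near=> h.
have h0 : 0 < h by near: h; exact: nbhs_right_gt.
by rewrite add0r mulrA divff ?gt_eqF// mul1r subrK.
Unshelve. all: by end_near. Qed.

(** The left derivative at [t] is minus the right derivative at [1 - t] of the reversed segment.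
    Both one-sided limits involve the same influence function, so they agree. *)
Lemma derive_segment mu nu (t : R) : 0 < t < 1 ->
  is_derive t 1 (fun s => J (segment mu nu s))
    (expect nu (Psi (segment mu nu t)) - expect mu (Psi (segment mu nu t))).
Proof.
move=> /andP[t0 t1].
have cvgdiff : h^-1 *: (J (segment mu nu (h *: (1 : R) + t)) - J (segment mu nu t)) @[h --> 0^'] -->
    expect nu (Psi (segment mu nu t)) - expect mu (Psi (segment mu nu t)).
  apply: (@cvg_at_right_left_dnbhs _ R^o).
    under eq_fun do rewrite [_ *: 1]mulr1 (addrC _ t).
    by apply: right_derivative_segment; rewrite ltW.
  apply/cvg_at_leftNP; rewrite oppr0.
  have := @right_derivative_segment nu mu (1 - t).
  rewrite segment_sym ?(ltW t0) ?(ltW t1)// => /(_ _)/wrap[]; first by lra.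
  move=> /cvgN cvgN'.
  have {}cvgN' : - (h^-1 * (J (segment nu mu (1 - t + h)) - J (segment mu nu t)))
      @[h --> 0^'+] -->
      expect nu (Psi (segment mu nu t)) - expect mu (Psi (segment mu nu t)).
    by rewrite opprB in cvgN'.
  apply: cvg_trans cvgN'; apply: near_eq_cvg; near=> h.
  have h0 : 0 < h by near: h; exact: nbhs_right_gt.
  have h1 : h < t by near: h; exact: nbhs_right_lt.
  rewrite /= [_ *: 1]mulr1 -(segment_sym mu nu); last by lra.
  rewrite (_ : 1 - _ = - h + t); last by ring.
  by rewrite invrN scaleNr.
apply: DeriveDef; first by apply/cvg_ex; eexists; exact: cvgdiff.
exact: cvg_lim cvgdiff.
Unshelve. all: by end_near. Qed.

Lemma mean_value_segment mu nu : exists2 t : R, 0 < t < 1 &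
  J nu - J mu = expect nu (Psi (segment mu nu t)) - expect mu (Psi (segment mu nu t)).
Proof.
pose phi (t : R) := J (segment mu nu t).
pose dphi (t : R) := expect nu (Psi (segment mu nu t)) - expect mu (Psi (segment mu nu t)).
have dphiE (t : R) : t \in `]0, 1[%R -> is_derive t 1 phi (dphi t).
  by rewrite in_itv /= => t01; exact: derive_segment.
have [|t t01] := @MVT R phi dphi 0 1 ltr01 dphiE.
  apply/continuous_within_itvP => //; split.
  - move=> t t01; apply/differentiable_continuous/derivable1_diffP.
    by have [] := dphiE _ t01.
  - by rewrite /phi segment0; exact: right_continuous_segment.
  (* Left continuity at 1 is right continuity at 0 of the reversed segment. *)
  - rewrite /phi segment1; apply/cvgrPdist_lt => e e0.
    have [r /= r0 hr] := iffLR (cvgrPdist_lt _ _) (right_continuous_segment nu mu) _ e0.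
    near=> t.
    have t1 : t < 1 by near: t; exact: nbhs_left_lt.
    have t0 : 0 < t by near: t; exact: nbhs_left_gt.
    have tr : 1 - r < t by near: t; apply: nbhs_left_gt; rewrite gtrBl.
    have := hr (1 - t); rewrite /= sub0r normrN gtr0_norm ?subr_gt0//.
    rewrite segment_sym ?ltW//; apply => //; lra.
rewrite /phi segment0 segment1 subr0 mulr1 => ->.
by exists t => //; move: t01; rewrite in_itv.
Unshelve. all: by end_near. Qed.

End mean_value.

(** * Differentials as first-order expansions *)

Lemma differentiable_near {R : realType} {V W : normedModType R} (f : V -> W)
    (df : {linear V -> W}) (x : V) : continuous df ->
  (forall e : R, 0 < e ->
    \forall h \near (0 : V), `|f (h + x) - f x - df h| <= e * `|h|) ->
  differentiable f x /\ 'd f x = df :> (V -> W).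
Proof.
move=> cdf fdf.
have E : f \o shift x = cst (f x) + df +o_ (0 : V) id.
  apply/eqaddoP => e e0; apply: filterS (fdf e e0) => h.
  by rewrite -addrA -opprD.
have dE := diff_unique cdf E; split => //.
by apply/diff_locallyP; rewrite dE.
Qed.

Lemma near_differentiable {R : realType} {V W : normedModType R} (f : V -> W)
    (x : V) (e : R) : differentiable f x -> 0 < e ->
  \forall h \near (0 : V), `|f (h + x) - f x - 'd f x h| <= e * `|h|.
Proof.
move=> df e0; have := iffLR (eqaddoP _ _ _ _) (diff_locally df) e e0.
by apply: filterS => h; rewrite -addrA -opprD.
Qed.

(** * First-order expansion of [J] along the parametrised family *)

Section chain_rule.
Context {R : realType} {X : pseudoPMetricType R}.
Local Notation P := (probability (borel X) R).
Hypothesis compactX : compact [set: X].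

Lemma continuous_bounded_continuous (f : X -> R) :
  continuous f -> bounded_continuous f.
Proof.
move=> cf; split=> //.
have [M [_ fM]] : bounded_set (f @` [set: X] : set R^o).
  apply: compact_bounded; apply: continuous_compact => //.
  exact: continuous_subspaceT.
by exists (M + 1) => x; apply: (fM (M + 1)); [rewrite ltrDl|exists x].
Qed.

Lemma difference_quotient_bounded (n : nat) (m : 'rV[R]_n -> P) theta :
  weakly_differentiable m ->
  exists B : R, forall h (f : X -> R) (M : R), bounded_continuous f ->
    (forall x, `|f x| <= M) ->
    `|expect (m (h + theta)) f - expect (m theta) f| <= B * M * `|h|.
Proof.
move=> dm.
(* The index [h] ranges over the whole space; at [h = 0] the inverse is 0 by convention and [D]
   vanishes. *)
pose D (h : 'rV[R]_n) (f : X -> R) : R :=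
  `|h|^-1 * (expect (m (h + theta)) f - expect (m theta) f).
have dist h f (M : R) : bounded_continuous f -> (forall x, `|f x| <= M) ->
    `|expect (m (h + theta)) f - expect (m theta) f| <= 2 * M.
  move=> bf fM; rewrite (le_trans (ler_normB _ _))// mulr2n mulrDl mul1r.
  by rewrite lerD// ler_norm_expect.
have [||||B DB] := @uniform_boundedness R X _ D.
- by move=> h f g bf bg; rewrite /D !expectD//; ring.
- by move=> h c f bf; rewrite /D !expectZ//; ring.
- move=> h; exists (`|h|^-1 * 2) => f M bf fM.
  by rewrite /D normrM normfV normr_id -mulrA ler_wpM2l ?invr_ge0//; exact: dist.
- move=> f bf; have [_ [M fM]] := bf.
  have df := dm f bf theta.
  have [k k0 dk] := linear_lipschitz (diff_continuous df).
  have /nbhs_ballP[r /= r0 hr] := near_differentiable _ _ _ df ltr01.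
  (* Within radius [r] the quotient is at most [k + 1], with [k] a Lipschitz constant of the
     differential and 1 the error of the expansion; beyond [r] the trivial bound [2 * M] is divided
     by at least [r]. *)
  exists (k + 1 + 2 * M / r) => h.
  have M0 : 0 <= M := le_trans (normr_ge0 _) (fM point).
  have Mr0 : 0 <= 2 * M / r by rewrite !mulr_ge0// invr_ge0 ltW.
  rewrite /D normrM normfV normr_id.
  have [->|h0] := eqVneq h 0.
    rewrite normr0 invr0 mul0r; lra.
  have nh0 : 0 < `|h| by rewrite normr_gt0.
  rewrite mulrC ler_pdivrMr//.
  have [hltr|rleh] := ltP `|h| r.
    have /= := hr h; rewrite -ball_normE /= sub0r normrN mul1r => /(_ hltr).
    set E := fun t => expect (m t) f.
    move=> qh; rewrite -(subrK ('d E theta h) (_ - _)).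
    rewrite (le_trans (ler_normD _ _))//.
    have := dk h; have := mulr_ge0 Mr0 (normr_ge0 h); rewrite !mulrDl; lra.
  rewrite (le_trans (dist _ _ _ bf fM))//.
  have : 2 * M <= 2 * M / r * `|h|.
    by rewrite mulrAC ler_pdivlMr// ler_wpM2l// mulr_ge0.
  have := mulr_ge0 (ltW k0) (normr_ge0 h); rewrite !mulrDl mul1r; lra.
exists B => h f M bf fM.
have [->|h0] := eqVneq h 0; first by rewrite add0r subrr !normr0 mulr0.
have := DB h f M bf fM; rewrite /D normrM normfV normr_id.
by rewrite mulrC ler_pdivrMr// normr_gt0.
Qed.

Variables (J : P -> R) (Psi : P -> X -> R).
Hypothesis inflJ : forall mu, influence_function J mu (Psi mu).
Hypothesis contPsi : weak_continuous2 (fun mu nu => expect nu (Psi mu)).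

Lemma expect_dirac_influence mu (x : X) : expect (\d_(x : borel X)) (Psi mu) = Psi mu x.
Proof.
apply: expect_dirac; have [/(_ mu) /integrableP[/measurable_EFinP]] := inflJ mu.
by [].
Qed.

(* Joint weak continuity of (mu, nu) |-> E_nu[Psi_mu], read at Dirac masses. *)
Lemma influence_jointly_continuous mu (x : X) (e : R) : 0 < e ->
  exists (k : nat) (f : 'I_k -> X -> R) (delta : R),
    [/\ forall i, bounded_continuous (f i), 0 < delta &
      \forall y \near x, forall mu', weak_ball mu f delta mu' ->
        `|Psi mu' y - Psi mu x| < e].
Proof.
move=> e0; have [k [f [g [delta [bf bg d0 H]]]]] := contPsi mu (\d_(x : borel X)) _ e0.
exists k, f, delta; split => //.
(* Only finitely many test functions define the weak neighbourhood, so the Dirac mass at [y] enters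
   it once [y] is close to [x]. *)
have near_g : \forall y \near x, forall i, `|g i y - g i x| < delta.
  apply: filter_forall => i; have [cg _] := bg i.
  near=> y; rewrite distrC; near: y; exact: (iffLR (cvgrPdist_lt _ _) (cg x) _ d0).
near=> y => mu' mu'f.
rewrite -!expect_dirac_influence; apply: H => // i.
have [cg _] := bg i.
rewrite !expect_dirac; do ?exact: continuous_borel_measurable.
move: i {cg}; near: y; exact: near_g.
Unshelve. all: by end_near. Qed.

(** Joint continuity is read with the measure held at [mu]; compactness then supplies the bound. *)
Lemma influence_bounded_continuous mu : bounded_continuous (Psi mu).
Proof.
apply: continuous_bounded_continuous => x; apply/cvgrPdist_lt => e e0.
have [k [f [delta [bf d0 H]]]] := influence_jointly_continuous mu x e e0.
near=> y; rewrite distrC.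
have : forall mu', weak_ball mu f delta mu' -> `|Psi mu' y - Psi mu x| < e by near: y.
by apply => i; rewrite subrr normr0.
Unshelve. all: by end_near. Qed.

Variables (n : nat) (m : 'rV[R]_n -> P) (theta : 'rV[R]_n).
Hypothesis dm : weakly_differentiable m.

Let mh (h : 'rV[R]_n) := m (h + theta).

(** Compactness makes the local estimates uniform in [x]. Uniformity in [t] comes from convexity of
    weak balls: one centred at [m theta] contains the whole segment as soon as it contains the other
    endpoint. *)
Lemma influence_uniform_near (e : R) : 0 < e ->
  \forall h \near (0 : 'rV[R]_n), forall x t, 0 <= t <= 1 ->
    `|Psi (segment (m theta) (mh h) t) x - Psi (m theta) x| < e.
Proof.
move=> e0; set mu := m theta; have e2 : 0 < e / 2 by rewrite divr_gt0.
suff : \forall h \near (0 : 'rV[R]_n), [set: X] `<=` (fun x => forall t, 0 <= t <= 1 ->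
    `|Psi (segment mu (mh h) t) x - Psi mu x| < e).
  by apply: filterS => h H x; exact: H.
have [B HB] := difference_quotient_bounded _ m theta dm.
have /compact_near_coveringP coverX := compactX.
apply: (coverX _ (nbhs (0 : 'rV[R]_n)) (fun h x => forall t, 0 <= t <= 1 ->
    `|Psi (segment mu (mh h) t) x - Psi mu x| < e)) => x _.
have [k [f [delta [bf d0 H]]]] := influence_jointly_continuous mu x _ e2.
pose A := [set h : 'rV[R]_n | forall i,
  `|expect (mh h) (f i) - expect mu (f i)| < delta].
have nearA : \forall h \near (0 : 'rV[R]_n), forall i,
    `|expect (mh h) (f i) - expect mu (f i)| < delta.
  apply: (@filter_forall _ _ _ (nbhs (0 : 'rV[R]_n)) (nbhs_filter (0 : 'rV[R]_n))) => i.
  have [_ [M fM]] := bf i.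
  (* Adding 1 keeps the denominator positive even when [B * M] is zero. *)
  have d'0 : 0 < delta / (`|B * M| + 1) by rewrite divr_gt0// ltr_wpDl.
  apply: (filterS _ (@nbhs0_lt R 'rV[R]_n _ d'0)) => h hd.
  apply: le_lt_trans (HB h _ _ (bf i) fM) _.
  rewrite ltr_pdivlMr ?ltr_wpDl// in hd; apply: le_lt_trans hd.
  by rewrite mulrC ler_wpM2l// (le_trans (ler_norm _))// lerDl.
exists ([set y | forall mu', weak_ball mu f delta mu' -> `|Psi mu' y - Psi mu x| < e / 2], A).
  by split.
move=> [y h] /= [Hy Ah] t t01.
have Hmu : weak_ball mu f delta mu by move=> i; rewrite subrr normr0.
have Hseg : weak_ball mu f delta (segment mu (mh h) t).
  move=> i; have ibf nu := bounded_continuous_integrable nu _ (bf i).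
  rewrite expect_segment//.
  rewrite (_ : _ - _ = t * (expect (mh h) (f i) - expect mu (f i))); last by ring.
  rewrite normrM; have /andP[t0 t1] := t01; rewrite ger0_norm//.
  by apply: le_lt_trans (Ah i); rewrite ler_piMl.
(* The local estimate compares with [Psi mu x], not [Psi mu y], so it is used twice, each time with
   [e / 2]. *)
rewrite (_ : _ - _ = (Psi (segment mu (mh h) t) y - Psi mu x) - (Psi mu y - Psi mu x)); last by ring.
have := Hy _ Hmu; have := Hy _ Hseg.
have := ler_normB (Psi (segment mu (mh h) t) y - Psi mu x) (Psi mu y - Psi mu x).
lra.
Unshelve. all: by end_near. Qed.

Lemma chain_rule_expansion (e : R) : 0 < e ->
  \forall h \near (0 : 'rV[R]_n), `|J (mh h) - J (m theta) -
    'd (fun t => expect (m t) (Psi (m theta))) theta h| <= e * `|h|.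
Proof.
move=> e0; set mu := m theta; set F := fun t => expect (m t) (Psi mu).
have bPsi := influence_bounded_continuous.
have dF : differentiable F theta by exact: dm.
have [B HB] := difference_quotient_bounded _ m theta dm.
(* The sign of [B] is unknown; [B'] is a positive number above it by which one can divide. *)
pose B' := `|B| + 1.
have B'0 : 0 < B' by rewrite ltr_wpDl.
have e2 : 0 < e / 2 by rewrite divr_gt0.
have e2B : 0 < e / 2 / B' by rewrite divr_gt0.
apply: filterS2 (near_differentiable _ _ _ dF e2) (influence_uniform_near _ e2B) => h oF unif.
have [t /andP[t0 t1] Jt] := mean_value_segment J Psi inflJ mu (mh h).
have {}unif x := ltW (unif x t (introT andP (conj (ltW t0) (ltW t1)))).
rewrite -/mu in unif; set Psit := Psi _ in Jt unif.
have bZ : bounded_continuous (fun x => -1 * Psi mu x) by exact/bounded_continuousZ/bPsi.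
have bdiff : bounded_continuous (fun x => Psit x + -1 * Psi mu x).
  by apply: bounded_continuousD => //; exact: bPsi.
have := HB h _ (e / 2 / B') bdiff.
move=> /(_ _)/wrap[]; first by move=> x; rewrite mulN1r.
rewrite !expectD ?expectZ//; do ?exact: bPsi.
rewrite -/mu -/(mh h) -/(F (h + theta)) -/(F theta) => key.
(* The error splits into the effect of replacing [Psit] by [Psi mu], bounded by [key], and the
   remainder of the expansion of [F], bounded by [oF]. *)
rewrite Jt (_ : _ - _ - _ = (expect (mh h) Psit + -1 * F (h + theta) -
   (expect mu Psit + -1 * F theta)) + (F (h + theta) - F theta - 'd F theta h));
  last by ring.
rewrite (le_trans (ler_normD _ _))//.
have : B * (e / 2 / B') * `|h| <= e / 2 * `|h|.
  rewrite ler_wpM2r// mulrCA ler_piMr ?(ltW e2)// ler_pdivrMr// mul1r.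
  by rewrite (le_trans (ler_norm _))// lerDl.
lra.
Qed.

End chain_rule.

Theorem theorem1 (R : realType) (X : pseudoPMetricType R)
  (n : nat)
  (J : probability (borel X) R -> R)
  (Psi : probability (borel X) R -> X -> R)
  (m : 'rV[R]_n -> probability (borel X) R) (theta : 'rV[R]_n) :
  hausdorff_space X ->
  compact [set: X] ->
  complete_space X ->
  separable_space X ->
  (forall mu, influence_function J mu (Psi mu)) ->
  weak_continuous2 (fun mu nu => expect nu (Psi mu)) ->
  weakly_differentiable m ->
  [/\ differentiable (fun t => J (m t)) theta,
      differentiable (fun t => expect (m t) (Psi (m theta))) theta &
      'd (fun t => J (m t)) theta =
      'd (fun t => expect (m t) (Psi (m theta))) theta :> ('rV[R]_n -> R)].
Proof.
move=> _ compactX _ _ inflJ contPsi dm.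
have dF : differentiable (fun t => expect (m t) (Psi (m theta))) theta.
  exact/dm/(influence_bounded_continuous compactX J Psi inflJ contPsi).
have [//||dJ dJE] := differentiable_near (fun t => J (m t))
  ('d (fun t => expect (m t) (Psi (m theta))) theta) theta; last by split.
  exact: diff_continuous.
exact: chain_rule_expansion.
Qed.
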